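(* Let $Q$ be a $\mathbb{Z}_n$-minimal quiver of Type A, a $\mathbb Z_n$-stable subquiver of $K_m$ with $m>1$, $m\mid n$. Any $T(n)$-action on the path algebra $\Bbbk Q$ (extending the $\mathbb Z_n$-action on $Q$) is given by $$x\cdot a^i_j=\gamma(\zeta^ja^i_j-\zeta^{i+1}\mu_{i,j}a^{i+1}_{j+1})+\lambda_{i,j}a^i_{j+1},$$ where $\gamma\in\Bbbk$ is the scalar with $x\cdot e_i=\gamma\zeta^i(e_i-\zeta e_{i+1})$, the $\mu_{i,j}\in\Bbbk^\times$ are the scalars with $g\cdot a^i_j=\mu_{i,j}a^{i+1}_{j+1}$, and $\lambda_{i,j}\in\Bbbk$, these scalars satisfying - $\mu_{i,i}=1$ for all $i$, and $\prod_{\ell=0}^{n-1}\mu_{i+\ell,j+\ell}=1$; - $\lambda_{i,j}=0$ if either $i=j$ or the arrow $a^i_{j+1}$ does not exist in $Q$ (where for $j+1\equiv i$ the trivial path $a^i_i=e_i$ counts as existing); - $\lambda_{i+1,j+1}\mu_{i,j}=\zeta\lambda_{i,j}\mu_{i,j+1}$. The superindices and subindices of arrows and scalars are taken modulo $m$.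
   Context: Let $n\ge2$ be an integer and $\Bbbk$ a field containing a primitive $n$-th root of unity $\zeta$. The Taft algebra $T(n)$ is the $n^2$-dimensional Hopf algebra generated by $g,x$ with relations $g^n=1$, $x^n=0$, $xg=\zeta gx$, and $\Delta(g)=g\otimes g$, $\Delta(x)=1\otimes x+x\otimes g$, $\varepsilon(g)=1$, $\varepsilon(x)=0$. The group generated by $g$ is identified with $\mathbb Z_n$. A Hopf algebra $H$ acts on an algebra $A$ if $A$ is a left $H$-module with $h\cdot(pq)=\sum(h_1\cdot p)(h_2\cdot q)$ and $h\cdot1_A=\varepsilon(h)1_A$. All actions on path algebras are assumed to preserve the path length filtration. $K_m$ is the quiver with vertices $1,\dots,m$ and one arrow $a^i_j$ from $i$ to $j$ for every ordered pair of distinct vertices; the symbol $a^i_i$ denotes the trivial path $e_i$. The generator $g$ of $\mathbb Z_n$ acts on vertices by $i\mapsto i+1$ modulo $m$, so $a^i_j\mapsto a^{i+1}_{j+1}$ on arrows. A $\mathbb Z_n$-minimal quiver of Type A is a $\mathbb Z_n$-stable subquiver of $K_m$ with $m>1$ dividing $n$. A $T(n)$-action on $\Bbbk Q$ extends the $\mathbb Z_n$-action on $Q$ if $g\cdot e_i=e_{i+1}$ and $g\cdot a^i_j$ is a nonzero scalar multiple $\mu_{i,j}a^{i+1}_{j+1}$ for all arrows $a^i_j$ of $Q$. Products in $\Bbbk Q$ compose paths left to right. The formulas and conditions are for pairs $(i,j)$ with $i=j$ or $a^i_j$ an arrow of $Q$; a term with factor $\lambda_{i,j}=0$ is read as zero.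 The scalar $\gamma$ exists for every $T(n)$-action, with $\gamma=0$ if $m<n$. *)

(* Defs.v *)
From HB Require Import structures.
From mathcomp Require Import all_boot all_order all_algebra.
From mathcomp Require Import finmap.
From mathcomp Require Import monalg.

Set Implicit Arguments.
Unset Strict Implicit.
Unset Printing Implicit Defensive.

Import GRing.Theory.
Local Open Scope ring_scope.

(* The linear map {malg k[K]} -> V with value f u on the basis element <<u>>. *)
HB.lock Definition linext (k : fieldType) (K : choiceType) (V : lmodType k)
  (f : K -> V) (p : {malg k[K]}) : V := \sum_(u <- msupp p) p@_u *: f u.
Canonical linext_unlockable := Unlockable linext.unlock.

Section LinearExtension.
Variables (k : fieldType) (K : choiceType) (V : lmodType k).
Implicit Types (f : K -> V) (p q : {malg k[K]}).

Lemma linextE f p (D : {fset K}) : (msupp p `<=` D)%fset ->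
  linext f p = \sum_(u <- D) p@_u *: f u.
Proof.
move=> sD; rewrite unlock; apply: big_fset_incl => // u _ up.
by rewrite mcoeff_outdom ?scale0r.
Qed.

Lemma linext_is_linear f : linear (linext f).
Proof.
move=> c p q.
set D := (msupp p `|` (msupp q `|` msupp (c *: p + q)))%fset.
have sp : (msupp p `<=` D)%fset by apply: fsubsetUl.
have sq : (msupp q `<=` D)%fset by rewrite /D fsetUCA; apply: fsubsetUl.
have sr : (msupp (c *: p + q) `<=` D)%fset.
  by rewrite /D fsetUA; apply: fsubsetUr.
rewrite !(linextE _ sp) (linextE _ sq) (linextE _ sr) scaler_sumr -big_split /=.
by apply: eq_bigr => u _; rewrite mcoeffD mcoeffZ scalerDl scalerA.
Qed.
HB.instance Definition _ f :=
  GRing.isLinear.Build k {malg k[K]} V _ (linext f) (linext_is_linear f).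

Lemma linext0 f : linext f 0 = 0.
Proof. exact: raddf0. Qed.

Lemma linextZ f c p : linext f (c *: p) = c *: linext f p.
Proof. exact: linearZ. Qed.

Lemma linextU f u : linext f << u >> = f u.
Proof.
have s1 : (msupp (<< u >> : {malg k[K]}) `<=` [fset u])%fset.
  by apply: msuppU_le.
by rewrite (linextE _ s1) big_seq_fset1 mcoeffUU scale1r.
Qed.

Lemma eq_linext f g p : f =1 g -> linext f p = linext g p.
Proof. by move=> fg; rewrite unlock; apply: eq_bigr => u _; rewrite fg. Qed.

End LinearExtension.

Lemma linext_comp (k : fieldType) (K : choiceType) (V W : lmodType k)
    (f : {linear V -> W}) (g : K -> V) p :
  f (linext g p) = linext (f \o g) p.
Proof. by rewrite unlock linear_sum; apply: eq_bigr => u _; rewrite linearZ. Qed.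

Lemma linext_linext (k : fieldType) (K L : choiceType) (V : lmodType k)
    (f : L -> V) (g : K -> {malg k[L]}) p :
  linext f (linext g p) = linext (fun u => linext f (g u)) p.
Proof. exact: linext_comp. Qed.

Lemma linext_swap (k : fieldType) (K L : choiceType) (V : lmodType k)
    (f : K -> L -> V) p q :
  linext (fun u => linext (f u) q) p = linext (fun v => linext (f^~ v) p) q.
Proof.
rewrite unlock; under eq_bigr do rewrite scaler_sumr.
rewrite exchange_big; apply: eq_bigr => v _; rewrite scaler_sumr.
by apply: eq_bigr => u _; rewrite !scalerA mulrC.
Qed.

Lemma linext_id (k : fieldType) (K : choiceType) (p : {malg k[K]}) :
  linext (fun u => << u >>) p = p.
Proof.
rewrite [RHS]monalgE unlock; apply: eq_bigr => u _.
by apply/malgP => v; rewrite mcoeffZ !mcoeffU mulr_natr.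
Qed.

(* A k-algebra with basis mb_sort, given by the products of basis elements. *)
Record multbasis (k : fieldType) := MultBasis {
  mb_sort :> choiceType;
  mb_mul : mb_sort -> mb_sort -> {malg k[mb_sort]};
  mb_one : {malg k[mb_sort]};
  mb_mulA : forall u v w,
    linext (mb_mul u) (mb_mul v w) = linext (mb_mul^~ w) (mb_mul u v);
  mb_mul1 : forall u, linext (mb_mul^~ u) mb_one = << u >>;
  mb_mulr1 : forall u, linext (mb_mul u) mb_one = << u >>;
  mb_one_neq0 : mb_one != 0
}.

Definition balg (k : fieldType) (B : multbasis k) : Type := {malg k[B]}.

Section BasedAlgebra.
Variables (k : fieldType) (B : multbasis k).

HB.instance Definition _ := GRing.Lmodule.on (balg B).

Definition bal_mul (p q : balg B) : balg B :=
  linext (fun u => linext (mb_mul u) q) p.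

Lemma bal_mulA : associative bal_mul.
Proof.
move=> p q r; rewrite /bal_mul linext_linext; apply: eq_linext => u.
rewrite !linext_linext; apply: eq_linext => v.
rewrite linext_linext linext_swap; apply: eq_linext => w.
exact: mb_mulA.
Qed.

Lemma bal_mul1 : left_id (mb_one B : balg B) bal_mul.
Proof.
move=> p; rewrite /bal_mul linext_swap -[RHS]linext_id.
by apply: eq_linext => u; rewrite mb_mul1.
Qed.

Lemma bal_mulr1 : right_id (mb_one B : balg B) bal_mul.
Proof.
move=> p; rewrite /bal_mul -[RHS]linext_id.
by apply: eq_linext => u; rewrite mb_mulr1.
Qed.

Lemma bal_mulDl : left_distributive bal_mul +%R.
Proof. by move=> p q r; rewrite /bal_mul raddfD. Qed.

Lemma bal_mulE (p q : balg B) :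
  bal_mul p q = linext (fun v => linext (fun u => mb_mul u v) p) q.
Proof. exact: linext_swap. Qed.

Lemma bal_mulDr : right_distributive bal_mul +%R.
Proof. by move=> p q r; rewrite !bal_mulE raddfD. Qed.

HB.instance Definition _ := GRing.Zmodule_isNzRing.Build (balg B)
  bal_mulA bal_mul1 bal_mulr1 bal_mulDl bal_mulDr (mb_one_neq0 B).

Lemma bal_scalerAl (c : k) (p q : balg B) : c *: (p * q) = (c *: p) * q.
Proof. by rewrite /GRing.mul /= /bal_mul linearZ. Qed.

HB.instance Definition _ :=
  GRing.Lmodule_isLalgebra.Build k (balg B) bal_scalerAl.

Lemma bal_scalerAr (c : k) (p q : balg B) : c *: (p * q) = p * (c *: q).
Proof.
by rewrite /GRing.mul /= !bal_mulE linearZ.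
Qed.

HB.instance Definition _ :=
  GRing.Lalgebra_isAlgebra.Build k (balg B) bal_scalerAr.

Definition bvec (u : B) : balg B := << u >>.

Lemma bvecM u v : bvec u * bvec v = mb_mul u v.
Proof. by rewrite /GRing.mul /= /bal_mul !linextU. Qed.

End BasedAlgebra.

Section Tensor.
Variable k : fieldType.

Definition pair_choice (K L : choiceType) : choiceType :=
  Choice.clone (K * L)%type _.

(* The pure tensor p (x) q, the tensor product of free modules being the free *)
(* module on pairs of basis elements.                                         *)
Definition tens (K L : choiceType) (p : {malg k[K]}) (q : {malg k[L]}) :
    {malg k[pair_choice K L]} :=
  linext (fun u => linext (fun v => << (u, v) >>) q) p.

Lemma tensU (K L : choiceType) (u : K) (v : L) :
  tens << u >> << v >> = << (u, v) >>.
Proof. by rewrite /tens !linextU. Qed.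

Lemma linext_tens (K L : choiceType) (V : lmodType k) (f : pair_choice K L -> V) p q :
  linext f (tens p q) = linext (fun u => linext (fun v => f (u, v)) q) p.
Proof.
rewrite /tens linext_linext; apply: eq_linext => u.
by rewrite linext_linext; apply: eq_linext => v; rewrite linextU.
Qed.

Lemma tens_linext (K L K' L' : choiceType) (f : K -> {malg k[K']})
    (g : L -> {malg k[L']}) p q :
  tens (linext f p) (linext g q)
  = linext (fun u => linext (fun v => tens (f u) (g v)) q) p.
Proof.
rewrite /tens linext_linext; apply: eq_linext => u.
rewrite [RHS]linext_swap; apply: eq_linext => u'.
by rewrite linext_linext.
Qed.

Lemma mcoeff_linext (K : choiceType) (p : {malg k[K]}) w :
  p@_w = linext (fun u => (u == w)%:R : k^o) p.
Proof.
rewrite -[in LHS](linext_id p) unlock raddf_sum; apply: eq_bigr => u _ /=.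
by rewrite mcoeffZ mcoeffU.
Qed.

Lemma mcoeff_tens (K L : choiceType) (p : {malg k[K]}) (q : {malg k[L]}) u v :
  (tens p q)@_(u, v) = p@_u * q@_v.
Proof.
rewrite (mcoeff_linext (tens p q)) linext_tens !mcoeff_linext.
rewrite unlock mulr_suml; apply: eq_bigr => x _.
rewrite /GRing.scale /= -mulrA !mulr_sumr.
apply: eq_bigr => y _; rewrite xpair_eqE /= -mulnb natrM; congr (_ * _).
by rewrite mulrCA.
Qed.

Variables B C : multbasis k.

Definition tens_mul (u v : pair_choice B C) : {malg k[pair_choice B C]} :=
  tens (mb_mul u.1 v.1) (mb_mul u.2 v.2).

Lemma tens_mulA u v w :
  linext (tens_mul u) (tens_mul v w) = linext (fun x => tens_mul x w) (tens_mul u v).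
Proof.
rewrite [LHS]linext_tens [RHS]linext_tens.
rewrite -[LHS](tens_linext (mb_mul u.1) (mb_mul u.2)).
rewrite -[RHS](tens_linext (fun x => mb_mul x w.1) (fun x => mb_mul x w.2)).
by rewrite !mb_mulA.
Qed.

Lemma tens_mul1 u : linext (fun v => tens_mul v u) (tens (mb_one B) (mb_one C)) = << u >>.
Proof. 
case: u => u v; rewrite linext_tens.
rewrite -[LHS](tens_linext (fun x => mb_mul x u) (fun x => mb_mul x v)).
by rewrite !mb_mul1 tensU.
Qed.

Lemma tens_mulr1 u : linext (tens_mul u) (tens (mb_one B) (mb_one C)) = << u >>.
Proof. 
case: u => u v; rewrite linext_tens.
by rewrite -[LHS](tens_linext (mb_mul u) (mb_mul v)) !mb_mulr1 tensU.
Qed.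

Lemma tens_one_neq0 : tens (mb_one B) (mb_one C) != 0.
Proof.
have nz (K : choiceType) (p : {malg k[K]}) : p != 0 -> exists u, p@_u != 0.
  case: (fset_0Vmem (msupp p)) => [s0 /eqP[]|[u up] _]; last first.
    by exists u; rewrite mcoeff_neq0.
  by apply/malgP => u; rewrite mcoeff_outdom ?mcoeff0 // s0.
have [u u0] := nz _ _ (mb_one_neq0 B); have [v v0] := nz _ _ (mb_one_neq0 C).
apply/eqP => /(congr1 (mcoeff (u, v))); rewrite mcoeff_tens mcoeff0 => /eqP.
by rewrite mulf_eq0 (negbTE u0) (negbTE v0).
Qed.

Definition tensor_basis : multbasis k :=
  MultBasis tens_mulA tens_mul1 tens_mulr1 tens_one_neq0.

End Tensor.

Section HopfAction.
Variables (k : fieldType) (B : multbasis k).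
Variables (Delta : balg B -> balg (tensor_basis B B)) (eps : balg B -> k).

(* In act_mul, (h_1 . p)(h_2 . q) is summed over the basis expansion of Delta h. *)
Record hopf_action (A : algType k) := HopfAction {
  act :> balg B -> A -> A;
  act_linearl : forall a, linear (act^~ a);
  act_linearr : forall h, linear (act h);
  act_1 : forall a, act 1 a = a;
  act_M : forall h h' a, act (h * h') a = act h (act h' a);
  act_mul : forall h p q, act h (p * q)
    = linext (fun u => act (bvec u.1) p * act (bvec u.2) q) (Delta h);
  act_one : forall h, act h 1 = eps h *: 1
}.

End HopfAction.

Section Taft.
Variables (k : fieldType) (n : nat) (zeta : k).
Hypotheses (n_gt1 : (1 < n)%N) (zetaP : n.-primitive_root zeta).

Definition taft_index : choiceType := Choice.clone ('I_n * 'I_n)%type _.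

Definition ord_mod (c : nat) : 'I_n := Ordinal (ltn_pmod c (ltnW n_gt1)).

(* The basis vector (a, b) is g ^ a * x ^ b, see taft_monomial below. *)
Definition taft_mul (u v : taft_index) : {malg k[taft_index]} :=
  if (u.2 + v.2 < n)%N then
    zeta ^+ (u.2 * v.1) *: << (ord_mod (u.1 + v.1), ord_mod (u.2 + v.2)) >>
  else 0.

Definition taft_one : {malg k[taft_index]} :=
  << (ord_mod 0, ord_mod 0) >>.

Lemma taft_mul_lt (u v : taft_index) : (u.2 + v.2 < n)%N ->
  taft_mul u v =
  zeta ^+ (u.2 * v.1) *: << (ord_mod (u.1 + v.1), ord_mod (u.2 + v.2)) >>.
Proof. by rewrite /taft_mul => ->. Qed.

Lemma taft_mul_ge (u v : taft_index) : (n <= u.2 + v.2)%N -> taft_mul u v = 0.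
Proof. by rewrite /taft_mul leqNgt => /negbTE ->. Qed.

Lemma taft_mulA u v w :
  linext (taft_mul u) (taft_mul v w)
  = linext (fun x => taft_mul x w) (taft_mul u v).
Proof.
have [lt_vw|le_vw] := ltnP (v.2 + w.2) n; last first.
  rewrite (taft_mul_ge le_vw) [LHS]linext0.
  have [lt_uv|le_uv] := ltnP (u.2 + v.2) n; last first.
    by rewrite (taft_mul_ge le_uv) [RHS]linext0.
  rewrite (taft_mul_lt lt_uv) [RHS]linextZ [in RHS]linextU taft_mul_ge ?scaler0 //=.
  by rewrite modn_small // -addnA (leq_trans le_vw) ?leq_addl.
rewrite (taft_mul_lt lt_vw) [LHS]linextZ [in LHS]linextU.
have [lt_uv|le_uv] := ltnP (u.2 + v.2) n; last first.
  rewrite (taft_mul_ge le_uv) [RHS]linext0 taft_mul_ge ?scaler0 //=.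
  by rewrite modn_small // addnA (leq_trans le_uv) ?leq_addr.
rewrite (taft_mul_lt lt_uv) [RHS]linextZ [in RHS]linextU.
have [lt_uvw|le_uvw] := ltnP (u.2 + v.2 + w.2) n; last first.
  by rewrite !taft_mul_ge ?scaler0 //= modn_small // addnA.
rewrite [in LHS]taft_mul_lt; last by rewrite /= modn_small // addnA.
rewrite [in RHS]taft_mul_lt; last by rewrite /= modn_small.
rewrite [LHS]scalerA [RHS]scalerA -!exprD.
have e1 : ord_mod (u.1 + (ord_mod (v.1 + w.1), ord_mod (v.2 + w.2)).1)
    = ord_mod ((ord_mod (u.1 + v.1), ord_mod (u.2 + v.2)).1 + w.1).
  by apply: val_inj; rewrite /= modnDmr modnDml addnA.
have e2 : ord_mod (u.2 + (ord_mod (v.1 + w.1), ord_mod (v.2 + w.2)).2)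
    = ord_mod ((ord_mod (u.1 + v.1), ord_mod (u.2 + v.2)).2 + w.2).
  by apply: val_inj; rewrite /= modnDmr modnDml addnA.
rewrite e1 e2; congr (_ *: _); rewrite /= (modn_small lt_uv).
rewrite -(prim_expr_mod zetaP) -[RHS](prim_expr_mod zetaP); congr (_ ^+ _).
rewrite -modnDmr modnMmr modnDmr; congr (_ %% _)%N.
by rewrite mulnDr mulnDl addnCA [in LHS](addnC (v.2 * w.1)%N).
Qed.

Lemma taft_mul1 u : linext (fun v => taft_mul v u) taft_one = << u >>.
Proof.
rewrite linextU /taft_mul /= !mod0n !add0n ltn_ord mul0n scale1r.
by case: u => a b; congr << (_, _) >>; apply: val_inj; rewrite /= modn_small.
Qed.

Lemma taft_mulr1 u : linext (taft_mul u) taft_one = << u >>.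
Proof.
rewrite linextU /taft_mul /= !mod0n !addn0 ltn_ord muln0 scale1r.
by case: u => a b; congr << (_, _) >>; apply: val_inj; rewrite /= modn_small.
Qed.

Lemma taft_one_neq0 : taft_one != 0.
Proof.
apply/eqP => /(congr1 (mcoeff (ord_mod 0, ord_mod 0))).
by rewrite mcoeffUU mcoeff0 => /eqP; rewrite oner_eq0.
Qed.

Definition taft_basis : multbasis k :=
  MultBasis taft_mulA taft_mul1 taft_mulr1 taft_one_neq0.

Local Notation taft := (balg taft_basis).

Definition taft_vec (a b : nat) : taft :=
  @bvec k taft_basis (ord_mod a, ord_mod b).
Definition taft_g : taft := taft_vec 1 0.
Definition taft_x : taft := taft_vec 0 1.

Lemma taft_vecM a b a' b' : (b < n)%N -> (b' < n)%N ->
  taft_vec a b * taft_vec a' b' =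
  if (b + b' < n)%N then zeta ^+ (b * a') *: taft_vec (a + a') (b + b') else 0.
Proof.
move=> lt_b lt_b'; rewrite /taft_vec bvecM.
change (taft_mul (ord_mod a, ord_mod b) (ord_mod a', ord_mod b') =
  if (b + b' < n)%N then
    zeta ^+ (b * a') *: << (ord_mod (a + a'), ord_mod (b + b')) >> else 0).
have eb : (ord_mod b : nat) = b by apply: modn_small.
have eb' : (ord_mod b' : nat) = b' by apply: modn_small.
case: ltnP => [lt|le]; last by rewrite taft_mul_ge //= !modn_small.
rewrite [LHS]taft_mul_lt; last by rewrite [_.2]/= eb [_.2]/= eb'.
have e1 : ord_mod (ord_mod a + ord_mod a') = ord_mod (a + a').
  by apply: val_inj; rewrite /= modnDml modnDmr.
have e2 : ord_mod (ord_mod b + ord_mod b') = ord_mod (b + b').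
  by apply: val_inj; rewrite /= modnDml modnDmr.
have e3 : zeta ^+ (ord_mod b * ord_mod a') = zeta ^+ (b * a').
  by rewrite eb -[LHS](prim_expr_mod zetaP) modnMmr (prim_expr_mod zetaP).
by rewrite [_.1 in LHS]/= [_.2 in LHS]/= e1 e2 e3.
Qed.

Lemma taft_vec_modl a b : taft_vec (a %% n) b = taft_vec a b.
Proof.
by congr (@bvec k taft_basis (_, _)); apply: val_inj; rewrite /= modn_mod.
Qed.

Lemma taft_gX a : taft_g ^+ a = taft_vec a 0.
Proof.
elim: a => // a IH; rewrite exprSr IH taft_vecM ?(ltnW n_gt1) //.
by rewrite mul0n scale1r addn1.
Qed.

Lemma taft_xX b : taft_x ^+ b = if (b < n)%N then taft_vec 0 b else 0.
Proof.
elim: b => [|b IH]; first by rewrite (ltnW n_gt1).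
rewrite exprSr IH; case: (ltnP b n) => [lt_b|le_b]; last first.
  by rewrite mul0r ltnNge (leq_trans le_b).
by rewrite taft_vecM // muln0 scale1r addn1.
Qed.

Lemma taft_monomial (u : taft_index) :
  @bvec k taft_basis u = taft_g ^+ u.1 * taft_x ^+ u.2.
Proof.
rewrite taft_gX taft_xX ltn_ord taft_vecM ?(ltnW n_gt1) // add0n ltn_ord.
rewrite mul0n scale1r addn0; congr (@bvec k taft_basis _); case: u => a b.
by congr (_, _); apply: val_inj; rewrite /= modn_small.
Qed.

Lemma taft_gn : taft_g ^+ n = 1.
Proof. by rewrite taft_gX -taft_vec_modl modnn. Qed.

Lemma taft_xn : taft_x ^+ n = 0.
Proof. by rewrite taft_xX ltnn. Qed.

Lemma taft_xg : taft_x * taft_g = zeta *: (taft_g * taft_x).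
Proof.
have n_gt0 := ltnW n_gt1.
by rewrite !taft_vecM // addn0 add0n n_gt1 mul0n muln1 expr1 scale1r.
Qed.

Local Notation taft2 := (balg (tensor_basis taft_basis taft_basis)).

(* Delta and epsilon, extended multiplicatively from the generators g, x to   *)
(* the basis g ^ a * x ^ b.                                                   *)
Definition taft_comul (h : taft) : taft2 :=
  linext (fun u : taft_basis =>
    (tens taft_g taft_g : taft2) ^+ u.1
    * (tens (1 : taft) taft_x + tens taft_x taft_g : taft2) ^+ u.2) h.

Definition taft_counit (h : taft) : k :=
  linext (fun u : taft_basis => (1 ^+ u.1 * 0 ^+ u.2 : k^o)) h.

Lemma taft_comul_g : taft_comul taft_g = tens taft_g taft_g.
Proof.
rewrite /taft_comul [LHS]linextU.
by rewrite [nat_of_ord _.1]modn_small // [nat_of_ord _.2]mod0n expr1 mulr1.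
Qed.

Lemma taft_comul_x :
  taft_comul taft_x = tens (1 : taft) taft_x + tens taft_x taft_g.
Proof.
rewrite /taft_comul [LHS]linextU.
by rewrite [nat_of_ord _.1]mod0n [nat_of_ord _.2]modn_small // expr1 mul1r.
Qed.

Definition taft_action (A : algType k) :=
  hopf_action taft_comul taft_counit A.

End Taft.

Record quiver := Quiver {
  qvert : finType;
  qarr : finType;
  qsrc : qarr -> qvert;
  qtgt : qarr -> qvert;
  qvert_gt0 : (0 < #|qvert|)%N
}.

Section PathAlgebra.
Variables (k : fieldType) (Q : quiver).

(* (v, s) encodes the path starting at v and following the arrows s from left *)
(* to right; (v, [::]) is the trivial path at v.                              *)
Fixpoint walk (v : qvert Q) (s : seq (qarr Q)) : bool :=
  if s is a :: s' then (qsrc a == v) && walk (qtgt a) s' else true.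

Definition qpath : choiceType :=
  Choice.clone {u : qvert Q * seq (qarr Q) | walk u.1 u.2} _.

Definition psrc (u : qpath) : qvert Q := (val u).1.
Definition parrows (u : qpath) : seq (qarr Q) := (val u).2.
Definition ptgt (u : qpath) : qvert Q :=
  last (psrc u) [seq qtgt a | a <- parrows u].
Definition plength (u : qpath) : nat := size (parrows u).

Definition ptriv (v : qvert Q) : qpath := exist _ (v, [::]) isT.

Lemma walk_cat v s t :
  walk v (s ++ t) = walk v s && walk (last v [seq qtgt a | a <- s]) t.
Proof. by elim: s v => //= a s IH v; rewrite IH andbA. Qed.

Lemma walk1 a : walk (qsrc a) [:: a].
Proof. by rewrite /= eqxx. Qed.

Definition parrow (a : qarr Q) : qpath := exist _ (qsrc a, [:: a]) (walk1 a).

(* Meaningful only when ptgt u = psrc v. *)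
Definition pcat (u v : qpath) : qpath :=
  insubd u (psrc u, parrows u ++ parrows v).

Definition path_mul (u v : qpath) : {malg k[qpath]} :=
  if ptgt u == psrc v then << pcat u v >> else 0.

Definition path_one : {malg k[qpath]} := \sum_v << ptriv v >>.

Lemma val_pcat u v : ptgt u = psrc v ->
  val (pcat u v) = (psrc u, parrows u ++ parrows v).
Proof.
move=> uv; rewrite val_insubd ifT //= walk_cat (valP u) /=.
by rewrite -/(ptgt u) uv (valP v).
Qed.

Lemma psrc_pcat u v : ptgt u = psrc v -> psrc (pcat u v) = psrc u.
Proof. by move=> uv; rewrite /psrc val_pcat. Qed.

Lemma parrows_pcat u v : ptgt u = psrc v ->
  parrows (pcat u v) = parrows u ++ parrows v.
Proof. by move=> uv; rewrite /parrows val_pcat. Qed.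

Lemma ptgt_pcat u v : ptgt u = psrc v -> ptgt (pcat u v) = ptgt v.
Proof.
move=> uv; rewrite /ptgt psrc_pcat // parrows_pcat // map_cat last_cat.
by rewrite -/(ptgt u) uv.
Qed.

Lemma pcatA u v w : ptgt u = psrc v -> ptgt v = psrc w ->
  pcat u (pcat v w) = pcat (pcat u v) w.
Proof.
move=> uv vw; apply: val_inj; rewrite !val_pcat ?psrc_pcat ?ptgt_pcat //.
by rewrite !parrows_pcat // catA.
Qed.

Lemma path_mul_cat u v : ptgt u = psrc v -> path_mul u v = << pcat u v >>.
Proof. by rewrite /path_mul => ->; rewrite eqxx. Qed.

Lemma path_mul_eq0 u v : ptgt u != psrc v -> path_mul u v = 0.
Proof. by rewrite /path_mul => /negbTE ->. Qed.

Lemma path_mulA u v w :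
  linext (path_mul u) (path_mul v w)
  = linext (fun x => path_mul x w) (path_mul u v).
Proof.
have [vw|vw] := eqVneq (ptgt v) (psrc w).
  rewrite (path_mul_cat vw) [LHS]linextU.
  have [uv|uv] := eqVneq (ptgt u) (psrc v).
    rewrite (path_mul_cat uv) [RHS]linextU.
    rewrite [LHS]path_mul_cat ?psrc_pcat //.
    by rewrite [RHS]path_mul_cat ?ptgt_pcat // pcatA.
  by rewrite (path_mul_eq0 uv) [RHS]linext0 path_mul_eq0 // psrc_pcat.
rewrite (path_mul_eq0 vw) [LHS]linext0.
have [uv|uv] := eqVneq (ptgt u) (psrc v); last first.
  by rewrite (path_mul_eq0 uv) [RHS]linext0.
by rewrite (path_mul_cat uv) [RHS]linextU path_mul_eq0 // ptgt_pcat.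
Qed.

Lemma linext_path_one (V : lmodType k) (f : qpath -> V) :
  linext f path_one = \sum_v f (ptriv v).
Proof. by rewrite /path_one raddf_sum; apply: eq_bigr => v _; apply: linextU. Qed.

Lemma path_mul1 u : linext (fun v => path_mul v u) path_one = << u >>.
Proof.
rewrite [LHS]linext_path_one (bigD1 (psrc u)) //= [X in _ + X]big1 => [|v vu].
  rewrite addr0 path_mul_cat //; congr << _ >>; apply: val_inj.
  by rewrite val_pcat //; case: u => [[]].
by rewrite path_mul_eq0.
Qed.

Lemma path_mulr1 u : linext (path_mul u) path_one = << u >>.
Proof.
rewrite [LHS]linext_path_one (bigD1 (ptgt u)) //= [X in _ + X]big1 => [|v vu].
  rewrite addr0 path_mul_cat //; congr << _ >>; apply: val_inj.
  by rewrite val_pcat //= cats0; case: u => [[]].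
by rewrite path_mul_eq0 // eq_sym.
Qed.

Lemma path_one_neq0 : path_one != 0.
Proof.
have /card_gt0P [v _] := qvert_gt0 Q.
apply/eqP => /(congr1 (mcoeff (ptriv v))); rewrite raddf_sum (bigD1 v) //=.
rewrite mcoeffUU big1 ?addr0 ?mcoeff0 => [|w wv]; last first.
  rewrite mcoeffU; case: eqP => // /(congr1 psrc) wv'.
  by case/eqP: wv.
by move/eqP; rewrite oner_eq0.
Qed.

Definition path_basis : multbasis k :=
  MultBasis path_mulA path_mul1 path_mulr1 path_one_neq0.

Definition pathalg := balg path_basis.

Definition pvertex (v : qvert Q) : pathalg := @bvec k path_basis (ptriv v).
Definition parr (a : qarr Q) : pathalg := @bvec k path_basis (parrow a).

Definition pfiltration (d : nat) (p : pathalg) : Prop :=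
  forall u : qpath, u \in msupp p -> (plength u <= d)%N.

End PathAlgebra.

Definition preserves_filtration (k : fieldType) (n : nat) (zeta : k)
    (n_gt1 : (1 < n)%N) (zetaP : n.-primitive_root zeta) (Q : quiver)
    (X : taft_action n_gt1 zetaP (pathalg k Q)) : Prop :=
  forall d h p, pfiltration d p -> pfiltration d (X h p).

(* The vertices 1, ..., m are encoded by their residues modulo m in 'I_m, and *)
(* ordS is i |-> i + 1 modulo m.  A subquiver of K_m on the vertices 'I_m is  *)
(* an irreflexive relation E, with E i j when the arrow from i to j is in Q.  *)
Section TypeA.
Variables (m : nat) (m_gt1 : (1 < m)%N) (E : rel 'I_m).

Definition Zn_stable_subquiver : Prop :=
  irreflexive E /\ (forall i j, E i j -> E (ordS i) (ordS j)).

Lemma card_ord_gt0 : (0 < #|'I_m|)%N.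
Proof. by rewrite card_ord ltnW. Qed.

Definition typeA_quiver : quiver :=
  @Quiver 'I_m {a : 'I_m * 'I_m | E a.1 a.2}
    (fun a => (val a).1) (fun a => (val a).2) card_ord_gt0.

(* The pairs (i, j) for which the symbol a^i_j denotes a path of Q. *)
Definition typeA_pair (i j : 'I_m) : bool := (i == j) || E i j.

Variable k : fieldType.

Definition evert (i : 'I_m) : pathalg k typeA_quiver :=
  @pvertex k typeA_quiver i.

(* a^i_j, with a^i_i = e_i, and 0 if there is no arrow from i to j in Q. *)
Definition aelt (i j : 'I_m) : pathalg k typeA_quiver :=
  if i == j then evert i
  else if insub (i, j) is Some a then @parr k typeA_quiver a else 0.

Definition extends_Zn_action (n : nat) (zeta : k)
    (n_gt1 : (1 < n)%N) (zetaP : n.-primitive_root zeta)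
    (X : taft_action n_gt1 zetaP (pathalg k typeA_quiver)) : Prop :=
  (forall i, X (taft_g n_gt1 zetaP) (evert i) = evert (ordS i)) /\
  (forall i j, E i j -> exists2 c : k, c != 0 &
     X (taft_g n_gt1 zetaP) (aelt i j) = c *: aelt (ordS i) (ordS j)).

End TypeA.

(* Main.v *)
From HB Require Import structures.
Require Import Defs.
From mathcomp Require Import all_boot all_order all_algebra.
From mathcomp Require Import finmap monalg.

(** An action of T(n) is determined by what g and x do, and x acts as a skew
    derivation: x (p q) = p (x q) + (x p) (g q).  The action of x on the vertices
    and on the arrows is read off from this rule applied to the idempotent
    relations of the path algebra, and the relations between the scalars are read
    off from g ^ n = 1 and x g = zeta g x.

    Vertices.  The filtration puts x e_i in the span of the vertices, and
    e_i e_i = e_i leaves only e_i and e_(i+1) there ([peirce_le0]).  Let alpha_i be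
    the coefficient of e_i.  From e_(i+1) e_i = 0 the coefficient of e_(i+1) is
    - alpha_(i+1), and from x g = zeta g x one gets alpha_(i+1) = zeta alpha_i.
    Hence alpha_i = gamma zeta ^ i with gamma = alpha_0, and going around the m
    vertices gives gamma = zeta ^ m gamma ([vertex_gamma_eq0]).

    Arrows.  Put a = a^i_j.  Expanding x on a = e_i a and on a = a e_j determines
    x a except for its corner e_i (x a) e_(j+1) ([tx_peirce]).  By the filtration
    that corner is spanned by paths of length at most one from i to j + 1, and
    there is at most one of these, a^i_(j+1) ([peirce_le1]); its coefficient is
    lambda_(i,j).  Comparing the coefficients of a^(i+1)_(j+2) in
    x (g a) = zeta g (x a) gives the recursion on lambda ([arrow_lambda_step]), and
    g ^ n = 1 gives the product formula for mu ([arrow_mu_orbit]). *)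

Set Implicit Arguments.
Unset Strict Implicit.
Unset Printing Implicit Defensive.

Import GRing.Theory.
Local Open Scope ring_scope.

(** * Actions of the Taft algebra through its generators *)

Lemma linextD (k : fieldType) (K : choiceType) (V : lmodType k)
    (f : K -> V) (p q : {malg k[K]}) :
  linext f (p + q) = linext f p + linext f q.
Proof. exact: raddfD. Qed.

Section TaftPair.
Variables (k : fieldType) (n : nat) (zeta : k) (A : algType k).

(** A T(n)-action on A, seen through its two generators: [tg] is an
    automorphism of order dividing n, [tx] is a skew derivation, and the two
    commute up to the factor zeta. *)
Record taft_pair := TaftPair {
  tg : A -> A;
  tx : A -> A;
  tg_linear : linear tg;
  tx_linear : linear tx;
  tgM : forall p q, tg (p * q) = tg p * tg q;
  txM : forall p q, tx (p * q) = p * tx q + tx p * tg q;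
  txg : forall p, tx (tg p) = zeta *: tg (tx p);
  tg_iter : forall p, iter n tg p = p
}.

Variable t : taft_pair.
Implicit Types (c : k) (p q : A).

HB.instance Definition _ :=
  GRing.isLinear.Build k A A *:%R (tg t) (tg_linear t).
HB.instance Definition _ :=
  GRing.isLinear.Build k A A *:%R (tx t) (tx_linear t).

Lemma tgZ c p : tg t (c *: p) = c *: tg t p.
Proof. exact: linearZ. Qed.

Lemma txZ c p : tx t (c *: p) = c *: tx t p.
Proof. exact: linearZ. Qed.

Lemma tx0 : tx t 0 = 0.
Proof. exact: linear0. Qed.

Lemma tg_lin2 c1 c2 p1 p2 :
  tg t (c1 *: p1 + c2 *: p2) = c1 *: tg t p1 + c2 *: tg t p2.
Proof. by rewrite linearD !linearZ. Qed.

Lemma tg_lin3 c1 c2 c3 p1 p2 p3 :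
  tg t (c1 *: p1 - c2 *: p2 + c3 *: p3)
  = c1 *: tg t p1 - c2 *: tg t p2 + c3 *: tg t p3.
Proof. by rewrite linearD linearB !linearZ. Qed.

(** Expanding x (e p) gives x p = e (x p) - alpha zeta mu p', because the e term
    of x e dies on g p.  Expanding x (p f) gives x p = beta p + (x p) f'.
    Substituting the second in the first leaves only the corner e (x p) f'. *)
Lemma tx_peirce (e e' f f' p p' : A) (alpha beta mu : k) :
    e * p = p -> p * f = p -> e' * p' = p' -> e * p' = 0 -> p * f' = 0 ->
    tg t f = f' -> tg t p = mu *: p' ->
    tx t e = alpha *: (e - zeta *: e') -> tx t f = beta *: (f - zeta *: f') ->
  tx t p = beta *: p - (alpha * zeta * mu) *: p' + e * tx t p * f'.
Proof.
move=> ep pf e'p' ep' pf' gf gp xe xf.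
have xr : tx t p = beta *: p + tx t p * f'.
  have {1}-> := esym (congr1 (tx t) pf).
  by rewrite txM xf gf -scalerAr mulrBr pf -scalerAr pf' scaler0 subr0.
have xl : tx t p = e * tx t p - (alpha * zeta * mu) *: p'.
  have {1}-> := esym (congr1 (tx t) ep).
  rewrite txM xe gp -scalerAl mulrBl -scalerAl -!scalerAr ep' e'p'.
  by rewrite scaler0 sub0r scalerN !scalerA.
by rewrite {1}xl {1}xr mulrDr -scalerAr ep mulrA addrAC.
Qed.

End TaftPair.

Section TaftAction.
Variables (k : fieldType) (n : nat) (zeta : k).
Variables (n_gt1 : (1 < n)%N) (zetaP : n.-primitive_root zeta).
Variables (A : algType k) (X : taft_action n_gt1 zetaP A).
Implicit Types (p q : A).

Local Notation g := (taft_g n_gt1 zetaP).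
Local Notation x := (taft_x n_gt1 zetaP).
Local Notation T := (balg (taft_basis n_gt1 zetaP)).

Lemma taft_actD (h h' : T) p : X (h + h') p = X h p + X h' p.
Proof. by have := act_linearl X p 1 h h'; rewrite !scale1r. Qed.

Lemma taft_act0 p : X 0 p = 0.
Proof. by apply: (addrI (X 0 p)); rewrite -taft_actD !addr0. Qed.

Lemma taft_actZ (c : k) (h : T) p : X (c *: h) p = c *: X h p.
Proof. by have := act_linearl X p c h 0; rewrite taft_act0 !addr0. Qed.

Lemma taft_actgM p q : X g (p * q) = X g p * X g q.
Proof.
by rewrite act_mul taft_comul_g /taft_g /taft_vec /bvec tensU linextU.
Qed.

Lemma taft_actxM p q : X x (p * q) = p * X x q + X x p * X g q.
Proof.
rewrite act_mul taft_comul_x; apply: etrans (linextD _ _ _) _.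
rewrite /taft_g /taft_x /taft_vec /bvec; congr (_ + _).
  rewrite [X in linext _ X]tensU [LHS]linextU; congr (_ * _).
  exact: (act_1 X).
by rewrite [X in linext _ X]tensU [LHS]linextU.
Qed.

Lemma taft_actxg p : X x (X g p) = zeta *: X g (X x p).
Proof. by rewrite -!act_M taft_xg taft_actZ. Qed.

Lemma taft_actg_iter p : iter n (X g) p = p.
Proof.
have actgX l : iter l (X g) p = X (g ^+ l) p.
  by elim: l => [|l /= ->]; rewrite ?act_1 // -act_M -exprS.
by rewrite actgX taft_gn act_1.
Qed.

Definition taft_pair_of : taft_pair n zeta A :=
  TaftPair (act_linearr X g) (act_linearr X x) taft_actgM taft_actxM
           taft_actxg taft_actg_iter.

End TaftAction.

(** * Coefficients in a path algebra *)

Section Coef.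
Variables (k : fieldType) (Q : quiver).
Implicit Types (p q : pathalg k Q) (u v w : qpath Q).

Definition pcoef u (p : pathalg k Q) : k := mcoeff u p.

Lemma pcoefD u p q : pcoef u (p + q) = pcoef u p + pcoef u q.
Proof. exact: mcoeffD. Qed.

Lemma pcoefZ u c p : pcoef u (c *: p) = c * pcoef u p.
Proof. exact: mcoeffZ. Qed.

Lemma pcoef_lin2 u c1 c2 p1 p2 :
  pcoef u (c1 *: p1 + c2 *: p2) = c1 * pcoef u p1 + c2 * pcoef u p2.
Proof. by rewrite pcoefD [X in X + _]pcoefZ [X in _ + X]pcoefZ. Qed.

Lemma pcoef_lin3 u c1 c2 c3 p1 p2 p3 :
  pcoef u (c1 *: p1 - c2 *: p2 + c3 *: p3)
  = c1 * pcoef u p1 - c2 * pcoef u p2 + c3 * pcoef u p3.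
Proof. by rewrite pcoefD -scaleNr pcoef_lin2 [X in _ + X]pcoefZ mulNr. Qed.

Lemma pcoefU u v : pcoef u (@bvec k (path_basis k Q) v) = (v == u)%:R.
Proof. exact: mcoeffU. Qed.

Lemma pcoefP p q : (forall u, pcoef u p = pcoef u q) -> p = q.
Proof. by move=> pq; apply/malgP. Qed.

Lemma path_mul_trivl i v :
  path_mul k (ptriv i) v = if psrc v == i then << v >> else 0.
Proof.
case: eqP => [vi|/eqP vi]; last first.
  by apply: path_mul_eq0; rewrite eq_sym.
rewrite (path_mul_cat _ (esym vi : ptgt (ptriv i) = psrc v)).
congr << _ >>; apply: val_inj.
by rewrite val_pcat //= -vi; case: {vi} v => [[]].
Qed.

Lemma path_mul_trivr i u :
  path_mul k u (ptriv i) = if ptgt u == i then << u >> else 0.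
Proof.
case: eqP => [ui|/eqP ui]; last exact: path_mul_eq0.
rewrite (path_mul_cat _ (ui : ptgt u = psrc (ptriv i))).
congr << _ >>; apply: val_inj.
by rewrite val_pcat //= cats0; case: {ui} u => [[]].
Qed.

(** A linear map that keeps some basis paths and kills the others acts
    diagonally, so it can be read off on coefficients. *)
Lemma pcoef_linext (f : qpath Q -> {malg k[qpath Q]}) (b : qpath Q -> bool) p u :
    (forall v, f v = if b v then << v >> else 0) ->
  pcoef u (linext f p) = if b u then pcoef u p else 0.
Proof.
move=> fE.
have fu v : linext (fun w => (w == u)%:R : k^o) (f v) = ((v == u) && b v)%:R.
  rewrite fE; case: (b v); first by rewrite [LHS]linextU andbT.
  by rewrite [LHS]linext0 andbF.
rewrite /pcoef mcoeff_linext linext_linext (eq_linext _ fu).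
case bu: (b u).
  rewrite [RHS]mcoeff_linext; apply: (@eq_linext k (qpath Q) k^o) => v.
  by case: eqVneq => [->|]; rewrite ?bu.
rewrite linext.unlock big1 // => v _.
have -> : (v == u) && b v = false by case: eqVneq => [->|].
exact: scaler0.
Qed.

Lemma pcoef_vertexM i p u :
  pcoef u (@pvertex k Q i * p) = if psrc u == i then pcoef u p else 0.
Proof.
rewrite /GRing.mul /= /bal_mul [X in pcoef _ X]linextU.
exact: pcoef_linext (path_mul_trivl i).
Qed.

Lemma pcoef_Mvertex i p u :
  pcoef u (p * @pvertex k Q i) = if ptgt u == i then pcoef u p else 0.
Proof.
rewrite /GRing.mul /= bal_mulE [X in pcoef _ X]linextU.
exact: pcoef_linext (path_mul_trivr i).
Qed.

Lemma pcoef_filtration d p u :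
  pfiltration d p -> (d < plength u)%N -> pcoef u p = 0.
Proof.
move=> pd du; apply: mcoeff_outdom; apply: contraL du => /pd.
by rewrite -leqNgt.
Qed.

Lemma pfiltrationU u : pfiltration (plength u) (@bvec k (path_basis k Q) u).
Proof. by move=> v /(fsubsetP msuppU_le); rewrite inE => /eqP->. Qed.

Lemma plength0 u : plength u = 0%N -> u = ptriv (psrc u).
Proof.
by move=> /size0nil u0; apply: val_inj; rewrite /= -u0; case: {u0} u => [[]].
Qed.

Lemma plength1 u : plength u = 1%N -> exists a, u = parrow a.
Proof.
case: u => [[v [|a [|b s]]] //= vs] _; exists a; apply: val_inj => /=.
by case/andP: vs => /eqP <-.
Qed.

End Coef.

(** * The cyclic shift of the vertices *)

Section OrdS.
Variable m : nat.
Implicit Types i : 'I_m.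

Lemma iter_ordS l i : (iter l (@ordS m) i : nat) = ((i + l) %% m)%N.
Proof.
elim: l => [|l IH] /=; first by rewrite addn0 modn_small.
by rewrite IH -addn1 modnDml -addnA addn1.
Qed.

Lemma iter_ordS_dvd l i : (m %| l)%N -> iter l (@ordS m) i = i.
Proof.
move=> /dvdnP[c ->]; apply: val_inj.
by rewrite [LHS]iter_ordS addnC modnMDl modn_small.
Qed.

Lemma iter_ordS0 (m_gt0 : (0 < m)%N) i : iter i (@ordS m) (Ordinal m_gt0) = i.
Proof. by apply: val_inj; rewrite [LHS]iter_ordS add0n modn_small. Qed.

Lemma ordS_neq i : (1 < m)%N -> ordS i != i.
Proof.
move=> m_gt1; apply/eqP => /(congr1 val) /= iS.
have: (i + 1 = i + 0 %[mod m])%N.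
  by rewrite addn1 iS addn0 modn_small.
by move/eqP; rewrite eqn_modDl mod0n modn_small.
Qed.

End OrdS.

(** * Peirce corners of low degree in Type A path algebras *)

Section TypeAQuiver.
Variables (m : nat) (m_gt1 : (1 < m)%N) (E : rel 'I_m).
Hypothesis EP : Zn_stable_subquiver E.
Variable k : fieldType.

Local Notation Q := (typeA_quiver m_gt1 E).
Local Notation e i := (evert m_gt1 E k i).
Local Notation a i j := (aelt m_gt1 E k i j).
Implicit Types (i j l : 'I_m) (u : qpath Q) (p : pathalg k Q).

(** The path named a^i_j, the trivial path at i standing in when there is no
    arrow from i to j.  As Q has no loop this also gives a^i_i = e_i. *)
Definition apath i j : qpath Q :=
  if insub (i, j) is Some b then @parrow Q b else @ptriv Q i.

Lemma typeA_pairii i : typeA_pair E i i.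
Proof. by rewrite /typeA_pair eqxx. Qed.

Lemma typeA_pairS i j : typeA_pair E i j -> typeA_pair E (ordS i) (ordS j).
Proof.
by case/orP => [/eqP->|/(EP.2) ij]; rewrite /typeA_pair ?eqxx // ij orbT.
Qed.

(** Stability only carries arrows forward, but m shifts make the identity, so
    m - 1 further shifts carry an arrow back. *)
Lemma typeA_pair_ordS i j : typeA_pair E (ordS i) (ordS j) = typeA_pair E i j.
Proof.
apply/idP/idP => [ij|]; last exact: typeA_pairS.
have pairX c :
    typeA_pair E (iter c (@ordS m) (ordS i)) (iter c (@ordS m) (ordS j)).
  by elim: c => // c; apply: typeA_pairS.
have := pairX m.-1; rewrite -!iterSr prednK ?(ltnW m_gt1) //.
by rewrite !iter_ordS_dvd.
Qed.

Lemma psrc_apath i j : psrc (apath i j) = i.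
Proof.
by rewrite /apath; case: insubP => //= b _ bij; rewrite /psrc /= bij.
Qed.

Lemma ptgt_apath i j : typeA_pair E i j -> ptgt (apath i j) = j.
Proof.
rewrite /apath; case: insubP => [b _ bij|/= nE]; first by rewrite /ptgt /= bij.
by rewrite /typeA_pair (negbTE nE) orbF => /eqP.
Qed.

Lemma evertE i : e i = a i i.
Proof. by rewrite /aelt eqxx. Qed.

Lemma apathii i : apath i i = @ptriv Q i.
Proof. by rewrite /apath; case: insubP => //= b; rewrite EP.1. Qed.

Lemma aeltE i j :
  a i j = if typeA_pair E i j then @bvec k (path_basis k Q) (apath i j) else 0.
Proof.
rewrite /aelt /typeA_pair; case: eqP => [<-|ij] /=; first by rewrite apathii.
by rewrite /apath; case: insubP => [b /= -> _|/= /negbTE->].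
Qed.

(** K_m has a single arrow between two distinct vertices and no loop, so the
    endpoints leave no choice.  This is what makes the low corners at most lines. *)
Lemma plength_le1 u : (plength u <= 1)%N ->
  typeA_pair E (psrc u) (ptgt u) /\ u = apath (psrc u) (ptgt u).
Proof.
case lu: (plength u) => [|[|//]] _.
  by rewrite (plength0 lu) /typeA_pair eqxx /psrc /ptgt /= apathii.
have [b ->] := plength1 lu; rewrite /typeA_pair /psrc /ptgt /=.
rewrite (valP b) orbT /apath; split=> //; case: insubP => [c _ cb|] /=.
  suff -> : b = c by [].
  by apply: val_inj; rewrite [LHS]surjective_pairing; apply: esym cb.
by rewrite (valP b).
Qed.

Lemma pcoef_aelt i l i' l' : typeA_pair E i l ->
  pcoef (apath i l) (a i' l') = ((i' == i) && (l' == l))%:R.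
Proof.
move=> il; rewrite aeltE; case: ifP => i'l'; last first.
  rewrite /pcoef mcoeff0; case: eqP => // i'i; case: eqP => // l'l.
  by move: i'l'; rewrite i'i l'l il.
rewrite pcoefU; congr (nat_of_bool _)%:R; apply/eqP/andP => [il'|].
  split; apply/eqP; first by rewrite -(psrc_apath i' l') il' psrc_apath.
  by rewrite -(ptgt_apath i'l') il' ptgt_apath.
by case=> /eqP-> /eqP->.
Qed.

Lemma pcoef_aeltM i p u :
  pcoef u (a i i * p) = if psrc u == i then pcoef u p else 0.
Proof. by rewrite -evertE; apply: pcoef_vertexM. Qed.

Lemma pcoef_Maelt j p u :
  pcoef u (p * a j j) = if ptgt u == j then pcoef u p else 0.
Proof. by rewrite -evertE; apply: pcoef_Mvertex. Qed.

Lemma pcoef_aelt_neq i j u : (psrc u != i) || (ptgt u != j) ->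
  pcoef u (a i j) = 0.
Proof.
rewrite aeltE; case: ifP => ij uij; last exact: mcoeff0.
rewrite pcoefU; case: eqP => // uE; move: uij.
by rewrite -uE psrc_apath ptgt_apath // !eqxx.
Qed.

Lemma aelt_idl i j : a i i * a i j = a i j.
Proof.
apply: pcoefP => u; rewrite pcoef_aeltM; case: ifPn => // ui.
by rewrite pcoef_aelt_neq ?ui.
Qed.

Lemma aelt_idr i j : a i j * a j j = a i j.
Proof.
apply: pcoefP => u; rewrite pcoef_Maelt; case: ifPn => // uj.
by rewrite pcoef_aelt_neq ?uj ?orbT.
Qed.

Lemma aelt_mul0l i j l : l != i -> a l l * a i j = 0.
Proof.
move=> li; apply: pcoefP => u; rewrite pcoef_aeltM [RHS]mcoeff0.
by case: eqP => // ul; rewrite pcoef_aelt_neq // ul li.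
Qed.

Lemma aelt_mul0r i j l : l != j -> a i j * a l l = 0.
Proof.
move=> lj; apply: pcoefP => u; rewrite pcoef_Maelt [RHS]mcoeff0.
by case: eqP => // ul; rewrite pcoef_aelt_neq // ul lj orbT.
Qed.

Lemma aelt_filtration i j : pfiltration 1 (a i j).
Proof.
rewrite aeltE; case: ifP => _; last by move=> u; rewrite msupp0 inE.
move=> u /pfiltrationU /leq_trans; apply; rewrite /apath.
by case: insubP.
Qed.

Lemma aelt_filtration0 i : pfiltration 0 (a i i).
Proof. by rewrite -evertE; apply: (@pfiltrationU k Q (@ptriv Q i)). Qed.

(** The corner of filtration degree one between e_i and e_l is at most a line.
    When (i, l) is not a pair, both sides vanish, whatever path [apath i l] is. *)
Lemma peirce_le1 i l p : pfiltration 1 p ->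
  a i i * p * a l l = pcoef (apath i l) p *: a i l.
Proof.
move=> p1; apply: pcoefP => u; rewrite pcoef_Maelt pcoef_aeltM pcoefZ.
have [/plength_le1[uP uE]|u_gt1] := leqP (plength u) 1; last first.
  rewrite !(pcoef_filtration _ u_gt1) ?mulr0 ?if_same //.
  exact: aelt_filtration.
rewrite [in RHS]uE pcoef_aelt // [i == _]eq_sym [l == _]eq_sym.
case: eqP => [ul|_]; last by rewrite andbF mulr0.
case: eqP => [ui|_]; last by rewrite mulr0.
by rewrite {1}uE ui ul mulr1.
Qed.

(** The hypothesis on p is what the Leibniz rule says about p = x e_i when
    applied to e_i e_i = e_i: a vertex other than i and i + 1 sees neither term. *)
Lemma peirce_le0 i p : pfiltration 0 p ->
    p = a i i * p + p * a (ordS i) (ordS i) ->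
  p = pcoef (apath i i) p *: a i i
      + pcoef (apath (ordS i) (ordS i)) p *: a (ordS i) (ordS i).
Proof.
move=> p0 pE; apply: pcoefP => u; rewrite [RHS]pcoef_lin2.
have [u0|u_gt0] := posnP (plength u); last first.
  rewrite !(pcoef_filtration _ u_gt0) ?mulr0 ?addr0 //;
    exact: aelt_filtration0.
have -> : u = apath (psrc u) (psrc u) by rewrite apathii; apply: plength0.
move: (psrc u) => v; have vv := typeA_pairii v.
rewrite !pcoef_aelt // !andbb.
have [<-|iv] := eqVneq i v.
  by rewrite (negbTE (ordS_neq i m_gt1)) mulr1 mulr0 addr0.
have [<-|Siv] := eqVneq (ordS i) v; first by rewrite mulr0 add0r mulr1.
rewrite !mulr0 addr0 pE pcoefD pcoef_aeltM pcoef_Maelt psrc_apath ptgt_apath //.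
by rewrite !ifF ?addr0 // eq_sym; apply: negbTE.
Qed.

End TypeAQuiver.

(** * The scalars of an action on a Type A path algebra *)

Lemma scaler_lin2B (R : pzRingType) (V : lmodType R) (c c1 c2 : R)
    (p1 p2 : V) :
  (c * c1) *: p1 - (c * c2) *: p2 = c *: (c1 *: p1 - c2 *: p2).
Proof. by rewrite scalerBr !scalerA. Qed.

Section TypeAAction.
Variables (k : fieldType) (n : nat) (zeta : k).
Hypothesis zetaP : n.-primitive_root zeta.
Variables (m : nat) (m_gt1 : (1 < m)%N) (m_dvd_n : (m %| n)%N).
Variables (E : rel 'I_m) (EP : Zn_stable_subquiver E).
Variable t : taft_pair n zeta (pathalg k (typeA_quiver m_gt1 E)).
Hypothesis t_filtered : forall d p, pfiltration d p -> pfiltration d (tx t p).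
Hypothesis t_vertex :
  forall i, tg t (evert m_gt1 E k i) = evert m_gt1 E k (ordS i).
Hypothesis t_arrow : forall i j, E i j -> exists2 c : k, c != 0 &
  tg t (aelt m_gt1 E k i j) = c *: aelt m_gt1 E k (ordS i) (ordS j).

Local Notation Q := (typeA_quiver m_gt1 E).
Local Notation a i j := (aelt m_gt1 E k i j).
Local Notation apath := (apath m_gt1 E).
Implicit Types (i j : 'I_m).

Definition arrow_mu i j : k := pcoef (apath (ordS i) (ordS j)) (tg t (a i j)).

Definition vertex_alpha i : k := pcoef (apath i i) (tx t (a i i)).

(** The test guards against the trivial path to which [apath i (ordS j)] falls
    back: for i = j the element x e_i may well have a nonzero coefficient there. *)
Definition arrow_lambda i j : k :=
  if typeA_pair E i (ordS j) then pcoef (apath i (ordS j)) (tx t (a i j)) else 0.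

Lemma tg_vertex i : tg t (a i i) = a (ordS i) (ordS i).
Proof. by rewrite -!evertE; apply: t_vertex. Qed.

Lemma tg_aelt i j : typeA_pair E i j ->
  arrow_mu i j != 0 /\ tg t (a i j) = arrow_mu i j *: a (ordS i) (ordS j).
Proof.
move=> ij.
have [c c0 gc]: exists2 c : k, c != 0 & tg t (a i j) = c *: a (ordS i) (ordS j).
  case/orP: (ij) => [/eqP<-|]; last exact: t_arrow.
  by exists 1; [exact: oner_neq0|rewrite scale1r tg_vertex].
have -> : arrow_mu i j = c; last by [].
by rewrite /arrow_mu gc pcoefZ (pcoef_aelt m_gt1 EP) ?typeA_pairS // !eqxx mulr1.
Qed.

Lemma arrow_mu_diag i : arrow_mu i i = 1.
Proof.
by rewrite /arrow_mu tg_vertex (pcoef_aelt m_gt1 EP) ?typeA_pairii // !eqxx.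
Qed.

Lemma iter_tg_aelt c i j : typeA_pair E i j ->
  iter c (tg t) (a i j)
  = (\prod_(l < c) arrow_mu (iter l (@ordS m) i) (iter l (@ordS m) j))
    *: a (iter c (@ordS m) i) (iter c (@ordS m) j).
Proof.
move=> ij; have ijX l : typeA_pair E (iter l (@ordS m) i) (iter l (@ordS m) j).
  by elim: l => // l; apply: typeA_pairS.
elim: c => [|c IH]; first by rewrite big_ord0 scale1r.
rewrite iterS IH [LHS]tgZ (tg_aelt (ijX c)).2 scalerA.
rewrite [\prod_(_ < c.+1) _]big_ord_recr; exact: erefl.
Qed.

(** As m divides n, the n-th power of g, which is the identity, sends a^i_j to a
    multiple of itself. *)
Lemma arrow_mu_orbit i j : typeA_pair E i j ->
  \prod_(l < n) arrow_mu (iter l (@ordS m) i) (iter l (@ordS m) j) = 1.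
Proof.
move=> ij; have := iter_tg_aelt n ij.
rewrite tg_iter 2?iter_ordS_dvd // => /(congr1 (pcoef (apath i j))).
by rewrite [RHS]pcoefZ (pcoef_aelt m_gt1 EP) // !eqxx mulr1 => <-.
Qed.

Lemma tx_vertex_span i : tx t (a i i) =
  vertex_alpha i *: a i i
  + pcoef (apath (ordS i) (ordS i)) (tx t (a i i)) *: a (ordS i) (ordS i).
Proof.
apply: (peirce_le0 EP); first by apply: t_filtered; apply: aelt_filtration0.
by rewrite -tg_vertex -txM (aelt_idl m_gt1 EP).
Qed.

(** Compare the e_(i+1) coefficients in x (g e_i) = zeta g (x e_i). *)
Lemma vertex_alphaS i : vertex_alpha (ordS i) = zeta * vertex_alpha i.
Proof.
rewrite {1}/vertex_alpha -tg_vertex txg pcoefZ; congr (_ * _).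
rewrite tx_vertex_span tg_lin2 !tg_vertex pcoef_lin2.
rewrite !(pcoef_aelt m_gt1 EP) ?typeA_pairii // eqxx.
by rewrite (negbTE (ordS_neq _ m_gt1)) mulr1 mulr0 addr0.
Qed.

Lemma tx_vertex i :
  tx t (a i i) = vertex_alpha i *: (a i i - zeta *: a (ordS i) (ordS i)).
Proof.
(* e_(i+1) and e_i are orthogonal, so x kills their product; the e_(i+1) *)
(* coefficient of the two Leibniz terms gives the relation.              *)
have betaE :
    pcoef (apath (ordS i) (ordS i)) (tx t (a i i)) = - vertex_alpha (ordS i).
  have : tx t (a (ordS i) (ordS i) * a i i) = 0.
    by rewrite (aelt_mul0l m_gt1 EP) ?ordS_neq // tx0.
  rewrite txM tg_vertex.
  move=> /(congr1 (pcoef (apath (ordS i) (ordS i)))).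
  rewrite pcoefD pcoef_aeltM pcoef_Maelt psrc_apath ptgt_apath ?typeA_pairii //.
  by rewrite eqxx [RHS]mcoeff0 => /eqP; rewrite addr_eq0 => /eqP.
rewrite [LHS]tx_vertex_span betaE vertex_alphaS scaleNr [RHS]scalerBr scalerA.
by rewrite [zeta * _]mulrC.
Qed.

Definition vertex_gamma : k := vertex_alpha (Ordinal (ltnW m_gt1)).

Lemma vertex_alpha_iter c i :
  vertex_alpha (iter c (@ordS m) i) = vertex_alpha i * zeta ^+ c.
Proof.
elim: c => [|c IH]; first by rewrite mulr1.
by rewrite iterS vertex_alphaS IH mulrCA exprS.
Qed.

Lemma vertex_alphaE i : vertex_alpha i = vertex_gamma * zeta ^+ i.
Proof. by rewrite -vertex_alpha_iter iter_ordS0. Qed.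

(** Going once around the m vertices multiplies gamma by zeta ^ m, which is not 1
    when m < n. *)
Lemma vertex_gamma_eq0 : (m < n)%N -> vertex_gamma = 0.
Proof.
move=> lt_mn; have /eqP := vertex_alpha_iter m (Ordinal (ltnW m_gt1)).
rewrite iter_ordS_dvd // -/vertex_gamma -{1}[vertex_gamma]mulr1.
rewrite -subr_eq0 -mulrBr mulf_eq0.
case/orP=> [/eqP //|]; rewrite subr_eq0 eq_sym -(prim_order_dvd zetaP).
by rewrite gtnNdvd // ltnW.
Qed.

Lemma tx_aelt i j : typeA_pair E i j ->
  tx t (a i j) =
    vertex_alpha j *: a i j
    - (vertex_alpha i * zeta * arrow_mu i j) *: a (ordS i) (ordS j)
    + arrow_lambda i j *: a i (ordS j).
Proof.
move=> ij; have Sneq l := ordS_neq l m_gt1.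
rewrite [LHS](@tx_peirce _ _ _ _ t (a i i) (a (ordS i) (ordS i))
  (a j j) (a (ordS j) (ordS j)) _ (a (ordS i) (ordS j))
  (vertex_alpha i) (vertex_alpha j) (arrow_mu i j)).
- congr (_ + _); rewrite (peirce_le1 EP); last first.
    by apply: t_filtered; apply: aelt_filtration.
  rewrite /arrow_lambda; case: ifP => [_|iSj]; first exact: erefl.
  by rewrite (aeltE m_gt1 EP k i (ordS j)) iSj 2!scaler0.
- exact: aelt_idl.
- exact: aelt_idr.
- exact: aelt_idl.
- by apply: aelt_mul0l => //; rewrite eq_sym.
- exact: aelt_mul0r.
- exact: tg_vertex.
- exact: (tg_aelt ij).2.
- exact: tx_vertex.
- exact: tx_vertex.
Qed.

Lemma tx_aelt_gamma i j : typeA_pair E i j ->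
  tx t (a i j) =
    vertex_gamma *: (zeta ^+ j *: a i j
              - (zeta ^+ i.+1 * arrow_mu i j) *: a (ordS i) (ordS j))
    + arrow_lambda i j *: a i (ordS j).
Proof.
move=> ij; rewrite (tx_aelt ij) !vertex_alphaE.
have -> : vertex_gamma * zeta ^+ i * zeta * arrow_mu i j
    = vertex_gamma * (zeta ^+ i.+1 * arrow_mu i j).
  by rewrite exprSr !mulrA.
exact: (congr1 (fun p => p + arrow_lambda i j *: a i (ordS j))
               (scaler_lin2B _ _ _ _ _)).
Qed.

(** For i = j this holds because x e_i lies in the span of the vertices. *)
Lemma arrow_lambda_eq0 i j :
  i = j \/ ~~ typeA_pair E i (ordS j) -> arrow_lambda i j = 0.
Proof.
case=> [<-|/negbTE]; rewrite /arrow_lambda; last by move=> ->.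
case: ifP => // iSi; rewrite tx_vertex_span.
rewrite pcoef_lin2 !(pcoef_aelt m_gt1 EP) //.
rewrite (negbTE (ordS_neq _ m_gt1)) eq_sym (negbTE (ordS_neq _ m_gt1)).
by rewrite andbF !mulr0 addr0.
Qed.

(** Compare the a^(i+1)_(j+2) coefficients in x (g a^i_j) = zeta g (x a^i_j).  The
    terms in gamma are multiples of a^(i+1)_(j+1) and a^(i+2)_(j+2), which do not
    contribute. *)
Lemma arrow_lambda_step i j : typeA_pair E i j ->
  arrow_lambda (ordS i) (ordS j) * arrow_mu i j
  = zeta * arrow_lambda i j * arrow_mu i (ordS j).
Proof.
move=> ij; have [iSj|niSj] := boolP (typeA_pair E i (ordS j)); last first.
  rewrite (arrow_lambda_eq0 (or_intror niSj)) arrow_lambda_eq0 ?mulr0 ?mul0r //.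
  by right; rewrite (typeA_pair_ordS m_gt1 EP).
have iSj' : typeA_pair E (ordS i) (ordS (ordS j)).
  by rewrite (typeA_pair_ordS m_gt1 EP).
have ij' : typeA_pair E (ordS i) (ordS j) by exact: typeA_pairS.
have := txg t (a i j).
rewrite (tg_aelt ij).2 [LHS]txZ (tx_aelt ij) tg_lin3.
rewrite (tg_aelt ij).2 (tg_aelt ij').2 (tg_aelt iSj).2 !scalerA.
move=> /(congr1 (pcoef (apath (ordS i) (ordS (ordS j))))).
rewrite [LHS]pcoefZ [RHS]pcoefZ pcoef_lin3 !(pcoef_aelt m_gt1 EP) // !eqxx.
rewrite (eq_sym (ordS j)) !(negbTE (ordS_neq _ m_gt1)) andbF !mulr0 subr0 add0r.
have <- : arrow_lambda (ordS i) (ordS j)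
    = pcoef (apath (ordS i) (ordS (ordS j))) (tx t (a (ordS i) (ordS j))).
  by rewrite /arrow_lambda iSj'.
by rewrite mulr1 mulrA mulrC.
Qed.

End TypeAAction.

Theorem theorem6p1 (k : fieldType) (n : nat) (zeta : k)
    (n_gt1 : (1 < n)%N) (zetaP : n.-primitive_root zeta)
    (m : nat) (m_gt1 : (1 < m)%N) (m_dvd_n : (m %| n)%N)
    (E : rel 'I_m) (EP : Zn_stable_subquiver E)
    (X : taft_action n_gt1 zetaP (pathalg k (typeA_quiver m_gt1 E)))
    (X_filtered : preserves_filtration X) (X_extends : extends_Zn_action X) :
  let g := taft_g n_gt1 zetaP in
  let x := taft_x n_gt1 zetaP in
  let e := @evert m m_gt1 E k in
  let a := @aelt m m_gt1 E k in
  exists (gamma : k) (mu lambda : 'I_m -> 'I_m -> k),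
    (* the scalars gamma and mu *)
    (forall i, X x (e i) = (gamma * zeta ^+ i) *: (e i - zeta *: e (ordS i))) /\
    ((m < n)%N -> gamma = 0) /\
    (forall i j, typeA_pair E i j ->
       mu i j != 0 /\ X g (a i j) = mu i j *: a (ordS i) (ordS j)) /\
    (* the action of x *)
    (forall i j, typeA_pair E i j ->
       X x (a i j) =
         gamma *: (zeta ^+ j *: a i j
                   - (zeta ^+ i.+1 * mu i j) *: a (ordS i) (ordS j))
         + lambda i j *: a i (ordS j)) /\
    (* the conditions on the scalars *)
    (forall i, mu i i = 1) /\
    (forall i j, typeA_pair E i j ->
       \prod_(l < n) mu (iter l (@ordS m) i) (iter l (@ordS m) j) = 1) /\
    (forall i j, typeA_pair E i j ->
       i = j \/ ~~ typeA_pair E i (ordS j) -> lambda i j = 0) /\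
    (forall i j, typeA_pair E i j ->
       lambda (ordS i) (ordS j) * mu i j = zeta * lambda i j * mu i (ordS j)).
Proof.
move=> g x e a; pose t := taft_pair_of X.
have t_filtered d p : pfiltration d p -> pfiltration d (tx t p).
  exact: X_filtered.
have t_vertex i : tg t (evert m_gt1 E k i) = evert m_gt1 E k (ordS i).
  exact: X_extends.1.
have t_arrow := X_extends.2.
exists (vertex_gamma t), (arrow_mu t), (arrow_lambda t).
refine (conj _ (conj _ (conj _ (conj _ (conj _ (conj _ (conj _ _))))))).
- move=> i; rewrite /e evertE evertE -(vertex_alphaE EP t_filtered t_vertex).
  exact: (tx_vertex EP t_filtered t_vertex).
- exact: (vertex_gamma_eq0 zetaP EP t_filtered t_vertex).
- exact: (tg_aelt EP t_vertex t_arrow).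
- exact: (tx_aelt_gamma EP t_filtered t_vertex t_arrow).
- exact: (arrow_mu_diag EP t_vertex).
- exact: (arrow_mu_orbit m_dvd_n EP t_vertex t_arrow).
- by move=> i j _; exact: (arrow_lambda_eq0 EP t_filtered t_vertex).
- exact: (arrow_lambda_step EP t_filtered t_vertex t_arrow).
Qed.
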